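(* Let $K\subset S^3$ be the figure eight knot. The set of hyperbolic distances between (distinct) canonical horospheres in the complete hyperbolic structure on $S^3\setminus K$ is precisely the set $$\left\{\log n \;\middle|\; n=\prod_p p^{k_p},\ p \text{ a rational prime},\ k_p\in\mathbb{N}\cup\{0\},\ k_p \text{ even for } p\equiv 2 \bmod 3\right\},$$ where the product runs over rational primes and all but finitely many $k_p$ are $0$.
   Context: Work in the upper half space model of hyperbolic 3-space $\mathbb{H}^3$. Let $\omega=-\frac12+\frac{\sqrt3}{2}i$, so $\mathbb{Z}[\omega]$ is the ring of Eisenstein integers. The complete hyperbolic structure on the figure eight knot complement (unique up to isometry) is $S^3\setminus K\cong\mathbb{H}^3/\Gamma$, where $$\Gamma=\langle A,B\rangle\subset \mathrm{SL}_2(\mathbb{Z}[\omega]),\qquad A=\begin{pmatrix}1&1\\0&1\end{pmatrix},\quad B=\begin{pmatrix}1&0\\-\omega&1\end{pmatrix},$$ acts on $\mathbb{H}^3$ through $\mathrm{PSL}_2(\mathbb{C})$ by isometries extending Möbius transformations of $\mathbb{C}\cup\{\infty\}$. A sufficiently small cusp neighbourhood of $S^3\setminus K$ lifts to an infinite family of disjoint horoballs in $\mathbb{H}^3$; expanding the cusp neighbourhood until these horoballs first become tangent gives the maximal cusp. The horospheres in $\mathbb{H}^3$ bounding the horoballs which are lifts of the maximal cusp are called the canonical horospheres of $S^3\setminus K$. Explicitly, they are the horospheres in the $\Gamma$-orbit of the horosphere centred at $\infty$ which is the horizontal Euclidean plane at height $1$. Any two distinct canonical horospheres are tangent or disjoint.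 The hyperbolic distance between two horospheres is the distance between them as subsets of $\mathbb{H}^3$, realised along the geodesic joining their centres (it is $0$ for tangent horospheres). *)

(* Defs.v *)
From HB Require Import structures.
From mathcomp Require Import all_boot all_order all_algebra.
From mathcomp Require Import all_classical all_reals all_analysis.
From mathcomp Require Import complex.

Set Implicit Arguments.
Unset Strict Implicit.
Unset Printing Implicit Defensive.

Import Order.TTheory GRing.Theory Num.Theory.

Local Open Scope classical_set_scope.
Local Open Scope complex_scope.
Local Open Scope ring_scope.

Section FigureEight.
Variable R : realType.

(* A pair [(z, t)] with [0 < t] is the point of the upper half space at height
   [t] above [z] in the complex plane; pairs with [t <= 0] are not points of
   hyperbolic space. *)
Definition H3 : set (R[i] * R) := [set p | 0 < p.2].

Definition abs2 (z : R[i]) : R := complex.Re z ^+ 2 + complex.Im z ^+ 2.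

Definition arcosh (x : R) : R := ln (x + Num.sqrt (x ^+ 2 - 1)).

(* cosh d(p, q) = 1 + |p - q|^2 / (2 p_3 q_3), with |p - q| the Euclidean
   distance in C x R. *)
Definition hdist (p q : R[i] * R) : R :=
  arcosh (1 + (abs2 (p.1 - q.1) + (p.2 - q.2) ^+ 2) / (2 * p.2 * q.2)).

Definition set_hdist (S T : set (R[i] * R)) : R :=
  inf [set hdist p q | p in S & q in T].

Definition mat2 (a b c d : R[i]) : 'M[R[i]]_2 :=
  \matrix_(i, j) (if i == 0 then (if j == 0 then a else b)
                  else (if j == 0 then c else d)).

(* The Poincare extension to H^3 of the Moebius transformation
   z |-> (a z + b) / (c z + d), in the form valid for a d - b c = 1. *)
Definition SL2_act (g : 'M[R[i]]_2) (p : R[i] * R) : R[i] * R :=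
  let a := g 0 0 in let b := g 0 1 in let c := g 1 0 in let d := g 1 1 in
  let z := p.1 in let t := p.2 in
  let D := abs2 (c * z + d) + abs2 c * t ^+ 2 in
  (((a * z + b) * conjc (c * z + d) + a * conjc c * (t ^+ 2)%:C) / D%:C, t / D).

Definition omega : R[i] := - (1 / 2) +i* (Num.sqrt 3 / 2).

Definition figA : 'M[R[i]]_2 := mat2 1 1 0 1.
Definition figB : 'M[R[i]]_2 := mat2 1 0 (- omega) 1.

Inductive Gamma : 'M[R[i]]_2 -> Prop :=
| Gamma_A : Gamma figA
| Gamma_B : Gamma figB
| Gamma_1 : Gamma 1%:M
| Gamma_mul g h : Gamma g -> Gamma h -> Gamma (g *m h)
| Gamma_inv g : Gamma g -> Gamma (invmx g).

(* The horosphere centred at infinity bounding the maximal cusp horoball. *)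
Definition horosphere_infty : set (R[i] * R) := [set p | H3 p /\ p.2 = 1].

Definition canonical_horosphere (S : set (R[i] * R)) : Prop :=
  exists2 g, Gamma g & S = SL2_act g @` horosphere_infty.

Definition canonical_distances : set R :=
  [set r | exists S T, [/\ canonical_horosphere S, canonical_horosphere T,
                           S <> T & r = set_hdist S T]].

End FigureEight.

Arguments omega R : clear implicits.
Arguments figA R : clear implicits.
Arguments figB R : clear implicits.
Arguments canonical_distances R : clear implicits.

(* The bound [N] expresses that all but finitely many exponents vanish. *)
Definition admissible (n : nat) : Prop :=
  exists (k : nat -> nat) (N : nat),
    [/\ forall p, prime p -> (N <= p)%N -> k p = 0%N,
        forall p, prime p -> (p = 2 %[mod 3])%N -> ~~ odd (k p)
      & n = (\prod_(0 <= p < N | prime p) p ^ k p)%N].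

(* Main.v *)
Require Import Defs.
From mathcomp Require Import all_boot all_order all_algebra all_field.
From mathcomp Require Import fingroup pgroup.
From mathcomp Require Import zify ring lra.
From mathcomp Require Import all_classical all_reals all_analysis.
From mathcomp Require Import complex.

(** If [k = (a, b; c, d)] lies in [SL2(C)] and [|c| >= 1], the horosphere
    [k H], image of the plane [H] at height one, is a Euclidean sphere of
    diameter [1 / |c|^2], and its hyperbolic distance to [H] is [ln |c|^2]
    ([set_hdist_horosphere]). Isometry invariance ([hdist_act], proved with the
    Hermitian matrix model [herm]) reduces any pair [g H], [h H] to [H], [k H]
    with [k = g^-1 h]; when [k] has Eisenstein entries the two horospheres
    coincide exactly when [c = 0]. So the canonical distances are the numbers
    [ln |c|^2], with [c] running over the nonzero lower left entries of elements
    of [Gamma].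

    As [Gamma] lies in [SL2(Z[omega])], each such [|c|^2] is the norm of an
    Eisenstein integer. Conversely every [c] in [Z[omega]] occurs up to a unit
    ([Gamma_lower_left]), because [Gamma] acts transitively on the cusps
    [Q(omega) u {oo}] ([Gamma_cusp_transitive]). For this, every Eisenstein
    integer [q] is sent to infinity by an element of [Gamma] with lower left
    entry a unit ([Gamma_pole_eis]), a finite check modulo the cusp lattice;
    such elements carry out the steps of Euclid's algorithm in [Z[omega]].

    It remains to see that the positive norms [x ^ 2 - x * y + y ^ 2] are
    the admissible integers ([admissible_eis_represented]): primes congruent to
    [2] mod [3] are inert in [Z[omega]], the others are norms, and norms
    multiply. *)

Set Implicit Arguments.
Unset Strict Implicit.
Unset Printing Implicit Defensive.

Import Order.TTheory GRing.Theory Num.Theory.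

Local Open Scope classical_set_scope.
Local Open Scope ring_scope.

(** * Norms of Eisenstein integers *)

(** The pair [(x, y)] stands for the Eisenstein integer [x + y * omega]; the
    product uses [omega ^ 2 = - 1 - omega]. *)
Definition eis_mul (z w : int * int) : int * int :=
  (z.1 * w.1 - z.2 * w.2, z.1 * w.2 + z.2 * w.1 - z.2 * w.2).

Definition eis_norm (z : int * int) : int := z.1 ^+ 2 - z.1 * z.2 + z.2 ^+ 2.

Lemma eis_normM z w : eis_norm (eis_mul z w) = eis_norm z * eis_norm w.
Proof. by case: z w => [x y] [u v]; rewrite /eis_norm /=; ring. Qed.

Lemma eis_norm_ge0 z : 0 <= eis_norm z.
Proof. by case: z => x y; rewrite /eis_norm /=; nia. Qed.

Lemma eis_norm_eq0 z : eis_norm z = 0 -> z = 0.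
Proof.
case: z => x y; rewrite /eis_norm /= => h.
have -> : x = 0 by nia.
by have -> : y = 0 by nia.
Qed.

(** Euclidean division with remainder of least absolute value. *)
Lemma round_div (u n : int) : 0 < n -> exists q, `|2 * (u - q * n)| <= n.
Proof.
move=> n0; exists ((2 * u + n) %/ (2 * n))%Z.
have := divz_eq (2 * u + n) (2 * n).
have := modz_ge0 (2 * u + n) (_ : 2 * n != 0).
have := @ltz_pmod (2 * u + n) (2 * n).
lia.
Qed.

(** [Z[omega]] is Euclidean for its norm: rounding both [omega]-coordinates of
    [z / w] to nearest integers leaves an error [s + t * omega] with
    [|s|, |t| <= 1/2], whose norm is at most [3/4]. *)
Lemma eis_euclid z w : 0 < eis_norm w ->
  exists q, eis_norm (z - eis_mul q w) < eis_norm w.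
Proof.
move=> n0; case: z w n0 => [a b] [c d] n0.
(* The two numerators are the coordinates of [z * conj w], and [z / w] is
   [z * conj w] divided by [eis_norm w]. *)
have [q hq] := round_div (a * (c - d) + b * d) n0.
have [r hr] := round_div (b * c - a * d) n0.
exists (q, r); rewrite -(ltr_pM2r n0) -[X in _ * X]/(eis_norm (c, d)).
set n := eis_norm (c, d) in n0 hq hr *.
set u := _ - q * n in hq; set v := _ - r * n in hr.
(* The remainder times [conj w] is [(u, v)]; compare norms. *)
have -> : eis_norm ((a, b) - eis_mul (q, r) (c, d)) * n = eis_norm (u, v).
  by rewrite /u /v /n /eis_norm /=; ring.
by rewrite /eis_norm /=; nia.
Qed.

Definition eis_represented (n : nat) : Prop := exists z, eis_norm z = n%:Z.

Lemma eis_representedM m n :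
  eis_represented m -> eis_represented n -> eis_represented (m * n).
Proof.
move=> [z hz] [w hw]; exists (eis_mul z w).
by rewrite eis_normM hz hw PoszM.
Qed.

(** In ['F_p] with [p = 3k + 2] cubing is injective, since
    [c = c ^ p = (c ^ 3) ^ k * c ^ 2] recovers a nonzero [c] from its cube. As
    [x ^ 3 + y ^ 3 = (x + y) * (x ^ 2 - x * y + y ^ 2)], a vanishing norm forces
    [x = - y], so the norm is [3 * y ^ 2] and [y = 0]. *)
Lemma prime_mod3_inert p z : prime p -> (p %% 3 = 2)%N ->
  (p %| eis_norm z)%Z -> (p %| z.1)%Z /\ (p %| z.2)%Z.
Proof.
case: z => x y pp p3; rewrite !(dvdz_pcharf (pchar_Fp pp)) /eis_norm /= => /eqP.
rewrite rmorphD rmorphB !rmorphXn rmorphM /=.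
move: (x%:~R : 'F_p) (y%:~R : 'F_p) => a b hab.
have frob (c : 'F_p) : c = (c ^+ 3) ^+ (p %/ 3) * c ^+ 2.
  rewrite -exprM -exprD mulnC -[X in (_ + X)%N]p3 -divn_eq.
  by have := expf_card c; rewrite card_Fp.
have cubes : a ^+ 3 = (- b) ^+ 3.
  apply/eqP; rewrite -subr_eq0.
  have -> : a ^+ 3 - (- b) ^+ 3 = (a + b) * (a ^+ 2 - a * b + b ^+ 2) by ring.
  by rewrite hab mulr0.
have ab : a = - b.
  have [a0|a0] := eqVneq a 0.
    move: cubes; rewrite a0 expr0n /= => /esym/eqP.
    by rewrite expf_eq0 /= => /eqP.
  have b0 : - b != 0.
    apply: contraNneq a0 => b0; move: cubes; rewrite b0 expr0n /= => /eqP.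
    by rewrite expf_eq0.
  have := frob a; have := frob (- b); rewrite -cubes.
  move: (_ ^+ (p %/ 3)) => s hb ha.
  have sb : s * (- b) = 1.
    by apply: (mulIf b0); rewrite mul1r -mulrA -expr2 -hb.
  have sa : s * a = 1 by apply: (mulIf a0); rewrite mul1r -mulrA -expr2 -ha.
  have s0 : s != 0.
    by apply/eqP => s0; move/eqP: sa; rewrite s0 mul0r eq_sym oner_eq0.
  by apply: (mulfI s0); rewrite sa sb.
have b0 : b == 0.
  have : 3%:R * b ^+ 2 = 0 by rewrite -hab ab; ring.
  move/eqP; rewrite mulf_eq0 expf_eq0 /= => /orP[|//].
  rewrite -(dvdn_pcharf (pchar_Fp pp)) dvdn_prime2 // => /eqP pe.
  by have := p3; rewrite [in (_ %% _)%N]pe.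
by rewrite b0 ab oppr_eq0.
Qed.

(** Inertness lets a factor [p] be divided out of both coordinates, which
    removes exactly [p ^ 2] from the norm. *)
Lemma eis_represented_even_logn p n : prime p -> (p %% 3 = 2)%N -> (0 < n)%N ->
  eis_represented n -> ~~ odd (logn p n).
Proof.
move=> pp p3; elim/ltn_ind: n => n IH n0 [z hz].
have [pn|pn] := boolP (p %| n)%N; last by rewrite lognE (negPf pn) !andbF.
have [] : (p %| z.1)%Z /\ (p %| z.2)%Z by apply: prime_mod3_inert; rewrite ?hz.
case/dvdzP => x hx; case/dvdzP => y hy.
have hn : n%:Z = eis_norm (x, y) * p%:Z ^+ 2.
  by rewrite -hz /eis_norm hx hy /=; ring.
have [m hm] : exists m : nat, eis_norm (x, y) = m.
  by move: (eis_norm_ge0 (x, y)); case: (eis_norm _) => // m _; exists m.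
have {}hn : n = (m * p ^ 2)%N.
  by apply/eqP; rewrite -eqz_nat hn hm PoszM -rmorphXn.
have m0 : (0 < m)%N by move: n0; rewrite hn muln_gt0 => /andP[].
have p1 := prime_gt1 pp.
rewrite hn lognM ?expn_gt0 ?(ltnW p1) // pfactorK // oddD addbF.
apply: IH => //; last by exists (x, y).
by rewrite hn; nia.
Qed.

(** A nontrivial cube root of unity modulo [p] exists because [3] divides the
    order [p - 1] of the unit group. *)
Lemma Fp_cube_root p : prime p -> (p %% 3 = 1)%N ->
  exists r : int, (p %| r ^+ 2 + r + 1)%Z.
Proof.
move=> pp p3.
have d3 : (3 %| #|[set: {unit 'F_p}]%SET|)%N.
  rewrite card_finField_unit card_Fp // -subn1 -eqn_mod_dvd ?prime_gt0 //.
  exact/eqP.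
have [u _ ou] := Cauchy (isT : prime 3) d3.
pose r := FinRing.uval u.
have r3 : r ^+ 3 = 1 by rewrite /r -FinRing.val_unitX -ou expg_order.
have r1 : r != 1.
  apply/eqP => r1; have : u = 1%g by apply: val_inj.
  by move=> u1; move: ou; rewrite u1 order1.
exists (r : nat)%:Z; rewrite (dvdz_pcharf (pchar_Fp pp)).
rewrite !rmorphD rmorphXn /= -pmulrn natr_Zp.
have : (r - 1) * (r ^+ 2 + r + 1) = 0.
  have -> : (r - 1) * (r ^+ 2 + r + 1) = r ^+ 3 - 1 by ring.
  by rewrite r3 subrr.
by move/eqP; rewrite mulf_eq0 subr_eq0 (negPf r1).
Qed.

(** Descent in the ideal generated by [p] and [z]: dividing [p] by [z] leaves a
    remainder whose norm is smaller and again divisible by [p]. When the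
    remainder vanishes, [z] divides [p] in [Z[omega]], and a norm divisible by
    [p], dividing [p ^ 2] and smaller than [p ^ 2] is [p] itself. *)
Lemma prime_dvd_small_eis_norm p z : prime p -> (p %| eis_norm z)%Z ->
  0 < eis_norm z < p%:Z ^+ 2 -> eis_represented p.
Proof.
move=> pp; have [n] := ubnP `|eis_norm z|%N.
elim: n z => // n IH z zn pz /andP[z0 zp].
have [q hq] := eis_euclid (p%:Z, 0) z0.
set w := _ - _ in hq.
have wE : eis_norm w = p%:Z * (p%:Z - 2 * (eis_mul q z).1 + (eis_mul q z).2)
    + eis_norm q * eis_norm z.
  rewrite -eis_normM /w; case: (eis_mul q z) => a b.
  by rewrite /eis_norm /=; ring.
have pw : (p %| eis_norm w)%Z.
  by rewrite wE; apply: rpredD; [apply: dvdz_mulr | apply: dvdz_mull].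
have [w0|w0] := eqVneq (eis_norm w) 0; last first.
  apply: (IH w) => //; have := eis_norm_ge0 w; first by lia.
  by rewrite le_eqVlt eq_sym (negPf w0) /= => ->; apply: lt_trans hq zp.
have qz : eis_norm q * eis_norm z = p%:Z ^+ 2.
  rewrite -eis_normM; move/eis_norm_eq0: w0 => /subr0_eq <-.
  by rewrite /eis_norm /=; ring.
case/dvdzP: pz => m zE; exists z.
have p1 := prime_gt1 pp; have q0 := eis_norm_ge0 q.
have mq : eis_norm q * m = p%:Z.
  have pn0 : p%:Z != 0 by lia.
  by apply: (mulIf pn0); rewrite -mulrA -zE qz.
have m0 : 0 < m by nia.
have mp : (`|m| %| p)%N.
  by rewrite -[p]/`|p%:Z|%N -mq abszM dvdn_mull.
case/primeP: pp => _ /(_ _ mp) /orP[] /eqP mE; last by nia.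
by rewrite zE; nia.
Qed.

Lemma eis_represented_split p : prime p -> (p %% 3 = 1)%N -> eis_represented p.
Proof.
move=> pp p3; have [r pr] := Fp_cube_root pp p3.
have p1 := prime_gt1 pp; have p0 : 0 < p%:Z by lia.
have [s hs] := round_div r p0.
(* Reducing [r] to [|x| <= p / 2] makes the norm of [x - omega] less than
   [p ^ 2]. *)
pose x := r - s * p%:Z; have hx : `|2 * x| <= p%:Z by [].
have xE : eis_norm (x, -1) = x ^+ 2 + x + 1 by rewrite /eis_norm /=; ring.
apply: (@prime_dvd_small_eis_norm p (x, -1)) => //; rewrite xE; last by nia.
have -> : x ^+ 2 + x + 1
    = r ^+ 2 + r + 1 + p%:Z * (s ^+ 2 * p%:Z - 2 * r * s - s).
  by rewrite /x; ring.
by apply: rpredD => //; apply: dvdz_mulr.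
Qed.

(** The primes behave in three ways in [Z[omega]]: [3] is the norm of
    [1 - omega], primes [1] mod [3] are norms, and primes [2] mod [3] enter
    norms only through their squares. *)
Lemma admissible_eis_represented n :
  admissible n <-> (0 < n)%N /\ eis_represented n.
Proof.
split=> [[k [N [_ keven ->]]]|[n0 rn]].
  split; first by rewrite prodn_cond_gt0 // => p pp; rewrite expn_gt0 prime_gt0.
  apply: (big_ind eis_represented).
  - by exists (1, 0); rewrite /eis_norm /=; ring.
  - exact: eis_representedM.
  move=> p pp.
  have powers m q : eis_represented q -> eis_represented (q ^ m).
    move=> rq; elim: m => [|m IH]; last by rewrite expnS; apply: eis_representedM.
    by exists (1, 0); rewrite /eis_norm /=; ring.
  have : (p %% 3 < 3)%N by rewrite ltn_mod.
  case E : (p %% 3)%N => [|[|[|//]]] _.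
  - apply: powers; have : (3 %| p)%N by rewrite /dvdn E.
    rewrite dvdn_prime2 // => /eqP <-.
    by exists (1, -1); rewrite /eis_norm /=; ring.
  - by apply: powers; apply: eis_represented_split.
  rewrite -(odd_double_half (k p)) (negPf (keven p pp E)) add0n -mul2n expnM.
  apply: powers; exists (p%:Z, 0).
  by rewrite -mulnn PoszM /eis_norm /=; ring.
exists (logn^~ n), n.+1; split.
- move=> p pp np; rewrite lognE pp n0 /=; case: ifP => // /(dvdn_leq n0) pn.
  by move: (leq_trans np pn); rewrite ltnn.
- by move=> p pp p3; apply: eis_represented_even_logn.
rewrite -[LHS](partnT n0) /partn big_mkcond [RHS]big_mkcond /=.
by apply: eq_bigr => p _; rewrite lognE; case: prime.
Qed.

Section EisensteinMatrices.
Variable R : realType.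
Local Open Scope complex_scope.
Implicit Types (x y z w : int * int) (q u v : R[i]) (g h : 'M[R[i]]_2).

(** * Eisenstein integers as complex numbers *)

Lemma abs2_ge0 u : 0 <= abs2 u.
Proof. by rewrite /abs2 addr_ge0 // sqr_ge0. Qed.

Lemma abs2M u v : abs2 (u * v) = abs2 u * abs2 v.
Proof. by case: u v => [a b] [c d]; rewrite /abs2 /=; ring. Qed.

Lemma abs2N u : abs2 (- u) = abs2 u.
Proof. by case: u => [a b]; rewrite /abs2 /= !sqrrN. Qed.

Lemma abs2_eq0 u : (abs2 u == 0) = (u == 0).
Proof.
case: u => a b; rewrite /abs2 /= paddr_eq0 ?sqr_ge0 // !sqrf_eq0.
by rewrite eq_complex.
Qed.

Definition eisC z : R[i] := z.1%:~R + z.2%:~R * omega R.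

Lemma omega_sqr : omega R * omega R = - 1 - omega R.
Proof.
have s3 : Num.sqrt (3 : R) * Num.sqrt 3 = 3 by rewrite -expr2 sqr_sqrtr.
by apply/eqP; rewrite eq_complex /=; apply/andP; split; apply/eqP; lra.
Qed.

Lemma eisCD z w : eisC (z + w) = eisC z + eisC w.
Proof. by rewrite /eisC /= !rmorphD /=; ring. Qed.

Lemma eisCN z : eisC (- z) = - eisC z.
Proof. by rewrite /eisC /= !rmorphN /=; ring. Qed.

Lemma eisCM z w : eisC (eis_mul z w) = eisC z * eisC w.
Proof.
rewrite /eisC /eis_mul /= !(rmorphD, rmorphN, rmorphM) /=.
move: (z.1%:~R) (z.2%:~R) (w.1%:~R) (w.2%:~R) => a b c d.
transitivity (a * c + (a * d + b * c) * omega R + b * d * (- 1 - omega R)).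
  by ring.
by rewrite -omega_sqr; ring.
Qed.

Lemma eisC0 : eisC 0 = 0.
Proof. by rewrite /eisC /= mul0r addr0. Qed.

Lemma eisC1 : eisC (1, 0) = 1.
Proof. by rewrite /eisC /= mul0r addr0. Qed.

Lemma abs2_eisC z : abs2 (eisC z) = (eis_norm z)%:~R.
Proof.
have s3 : Num.sqrt (3 : R) * Num.sqrt 3 = 3 by rewrite -expr2 sqr_sqrtr.
rewrite /eisC /eis_norm /abs2 -!(rmorph_int (real_complex R)) /=.
rewrite rmorphD rmorphB !rmorphXn rmorphM /=.
move: (z.1%:~R) (z.2%:~R) => a b.
transitivity ((a - b / 2) ^+ 2 + b ^+ 2 / 4 * (Num.sqrt 3 * Num.sqrt 3)).
  by field.
by rewrite s3; field.
Qed.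

(** Norms of Eisenstein integers are nonnegative integers, so units have norm
    one. *)
Lemma eisC_unit_norm z w : eisC z * eisC w = 1 -> eis_norm z = 1.
Proof.
rewrite -eisCM -eisC1 => /(congr1 (@abs2 R)); rewrite !abs2_eisC => /eqP.
rewrite eqr_int eis_normM => /eqP zw; have z0 := eis_norm_ge0 z.
have := dvdz_mulr (eis_norm w) (dvdzz (eis_norm z)).
by rewrite zw dvdz1 => /eqP; lia.
Qed.

(** * Two by two matrices with Eisenstein entries *)

Definition eis_mat x y z w : 'M[R[i]]_2 :=
  mat2 (eisC x) (eisC y) (eisC z) (eisC w).

Lemma mat2E (g : 'M[R[i]]_2) : g = mat2 (g 0 0) (g 0 1) (g 1 0) (g 1 1).
Proof.
apply/matrixP => i j; rewrite mxE.
by case: (unliftP 0 i) => [i'|] ->; case: (unliftP 0 j) => [j'|] ->;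
   rewrite ?(ord1 i') ?(ord1 j') //=; congr (g _ _); apply: val_inj.
Qed.

Lemma mat2M (a b c d a' b' c' d' : R[i]) :
  mat2 a b c d *m mat2 a' b' c' d' =
  mat2 (a * a' + b * c') (a * b' + b * d') (c * a' + d * c') (c * b' + d * d').
Proof.
by rewrite [LHS]mat2E; congr mat2; rewrite !mxE !big_ord_recl big_ord0 !mxE /= addr0.
Qed.

Lemma det_mat2 (a b c d : R[i]) : \det (mat2 a b c d) = a * d - b * c.
Proof.
rewrite (expand_det_row _ 0) !big_ord_recl big_ord0 /cofactor !det_mx11 !mxE /=.
by ring.
Qed.

Lemma mat2_1 : 1%:M = mat2 1 0 0 1 :> 'M[R[i]]_2.
Proof. by rewrite [LHS]mat2E !mxE. Qed.

Lemma invmx_mat2 (a b c d : R[i]) : a * d - b * c = 1 ->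
  invmx (mat2 a b c d) = mat2 d (- b) (- c) a.
Proof.
move=> dt; have U : mat2 a b c d \in unitmx by rewrite unitmxE det_mat2 dt unitr1.
apply: (can_inj (mulKmx U)); rewrite mulmxV // mat2M mat2_1.
by congr mat2; rewrite -?dt; ring.
Qed.

Lemma eis_matM x y z w x' y' z' w' :
  eis_mat x y z w *m eis_mat x' y' z' w' =
  eis_mat (eis_mul x x' + eis_mul y z') (eis_mul x y' + eis_mul y w')
          (eis_mul z x' + eis_mul w z') (eis_mul z y' + eis_mul w w').
Proof. by rewrite /eis_mat mat2M !eisCD !eisCM. Qed.

Lemma invmx_eis_mat x y z w :
  \det (eis_mat x y z w) = 1 -> invmx (eis_mat x y z w) = eis_mat w (- y) (- z) x.
Proof. by rewrite det_mat2 => /invmx_mat2; rewrite /eis_mat !eisCN. Qed.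

(** * The figure eight knot group has one cusp *)

Definition SL2_eis (g : 'M[R[i]]_2) : Prop :=
  \det g = 1 /\ exists x y z w, g = eis_mat x y z w.

Lemma SL2_eis_inv g : SL2_eis g -> SL2_eis (invmx g).
Proof.
move=> [dg [a [b [c [d gE]]]]]; split; first by rewrite det_inv dg invr1.
by rewrite gE invmx_eis_mat -?gE //; do 4!eexists.
Qed.

Lemma figA_eis : figA R = eis_mat (1, 0) (1, 0) 0 (1, 0).
Proof. by rewrite /eis_mat !eisC1 eisC0. Qed.

Lemma figB_eis : figB R = eis_mat (1, 0) 0 (0, -1) (1, 0).
Proof.
rewrite /eis_mat !eisC1 eisC0 /figB; congr mat2.
by rewrite /eisC /=; ring.
Qed.

Lemma Gamma_SL2_eis (g : 'M[R[i]]_2) : Gamma g -> SL2_eis g.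
Proof.
elim=> {g} [||| g h _ [dg [x [y [z [w gE]]]]] _ [dh [x' [y' [z' [w' hE]]]]]
  | g _].
- split; first by rewrite det_mat2; ring.
  by rewrite figA_eis; do 4!eexists.
- split; first by rewrite det_mat2; ring.
  by rewrite figB_eis; do 4!eexists.
- split; first by rewrite det1.
  by exists (1, 0), 0, 0, (1, 0); rewrite mat2_1 /eis_mat eisC1 eisC0.
- split; first by rewrite det_mulmx dg dh mulr1.
  by rewrite gE hE eis_matM; do 4!eexists.
exact: SL2_eis_inv.
Qed.

(** [q] is a point that an element of [Gamma] with lower left entry of modulus
    one sends to infinity; equivalently, [q] is the base point of a canonical
    horosphere of Euclidean diameter one. *)
Definition Gamma_pole (q : R[i]) : Prop :=
  exists2 g, Gamma g & g 1 1 = - q * g 1 0 /\ abs2 (g 1 0) = 1.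

Lemma Gamma_pole_eis_mat x y z w (p : int * int) : Gamma (eis_mat x y z w) ->
  eis_norm z = 1 -> w = - eis_mul p z -> Gamma_pole (eisC p).
Proof.
move=> G zn wE; exists (eis_mat x y z w) => //; rewrite !mxE /=.
by rewrite abs2_eisC zn wE eisCN eisCM mulNr.
Qed.

(** Poles are permuted by the parabolic elements of [Gamma] fixing infinity;
    [mat2 e f 0 e] with [e ^ 2 = 1] is the translation by [e * f]. *)
Lemma Gamma_pole_shift (e f q : R[i]) (n : int) :
  e * e = 1 -> Gamma (mat2 e f 0 e) -> Gamma_pole q ->
  Gamma_pole (q + n%:~R * (e * f)).
Proof.
move=> ee Gh; have e2 : abs2 e = 1.
  apply/eqP; rewrite -(@eqrXn2 _ 2) ?abs2_ge0 ?ler01 // expr2 -abs2M ee.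
  by rewrite /abs2 /=; apply/eqP; ring.
have step f' q' : Gamma (mat2 e f' 0 e) -> Gamma_pole q' ->
    Gamma_pole (q' - e * f').
  move=> Gf [g Gg [g11 g10]]; exists (g *m mat2 e f' 0 e); first exact: Gamma_mul.
  rewrite [g]mat2E mat2M !mxE /= mulr0 addr0 abs2M g10 e2 mulr1; split=> //.
  by rewrite g11; transitivity (- q' * g 1 0 * e + g 1 0 * f' * (e * e));
    [rewrite ee; ring | ring].
have Gh' : Gamma (mat2 e (- f) 0 e).
  by have := Gamma_inv Gh; rewrite invmx_mat2 ?oppr0 // mulr0 subr0.
move=> Gq; case: n => n; last rewrite NegzE; elim: n => [|n IH].
- by rewrite mul0r addr0.
- have := step _ _ Gh' IH; congr Gamma_pole.
  by rewrite intS rmorphD /=; ring.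
- have := step _ _ Gh Gq; congr Gamma_pole.
  by ring.
- have := step _ _ Gh IH; congr Gamma_pole.
  by rewrite (intS n.+1) !rmorphN !rmorphD /=; ring.
Qed.

Lemma Gamma_invB : Gamma (eis_mat (1, 0) 0 (0, 1) (1, 0)).
Proof.
have := Gamma_inv (@Gamma_B R); rewrite figB_eis invmx_eis_mat //.
by rewrite -figB_eis det_mat2; ring.
Qed.

Lemma Gamma_invA : Gamma (eis_mat (1, 0) (-1, 0) 0 (1, 0)).
Proof.
have := Gamma_inv (@Gamma_A R); rewrite figA_eis invmx_eis_mat //.
by rewrite -figA_eis det_mat2; ring.
Qed.

(** The longitude of the knot, as the word
    [B A^-1 B^-1 A A B^-1 A^-1 B]: up to sign it is the translation by
    [2 + 4 * omega = 2 * sqrt (-3)]. Together with [A] it generates the cusp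
    lattice, of index [4] in [Z[omega]]. *)
Lemma Gamma_longitude : Gamma (eis_mat (-1, 0) (-2, -4) 0 (-1, 0)).
Proof.
have GA := @Gamma_A R; have GB := @Gamma_B R.
have := Gamma_mul (Gamma_mul (Gamma_mul (Gamma_mul GB Gamma_invA)
  (Gamma_mul Gamma_invB GA)) (Gamma_mul GA Gamma_invB))
  (Gamma_mul Gamma_invA GB).
by rewrite figA_eis figB_eis !eis_matM.
Qed.

(** The cusp lattice has index [4] in [Z[omega]], the coset of [x + y * omega]
    being determined by [y] mod [4]. It is enough to exhibit one pole in each
    coset, and [B], [B^-1], [B A B^-1], [B A^-1 B^-1] provide them. *)
Lemma Gamma_pole_eis (q : int * int) : Gamma_pole (eisC q).
Proof.
have poleB : Gamma_pole (eisC (-1, -1)).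
  by have := @Gamma_B R; rewrite figB_eis => /Gamma_pole_eis_mat; apply.
have poleb : Gamma_pole (eisC (1, 1)).
  by have := Gamma_invB => /Gamma_pole_eis_mat; apply.
have poleBAb : Gamma_pole (eisC (1, 2)).
  have := Gamma_mul (Gamma_mul (@Gamma_B R) (@Gamma_A R)) Gamma_invB.
  by rewrite figA_eis figB_eis !eis_matM => /Gamma_pole_eis_mat; apply.
have poleBab : Gamma_pole (eisC (1, 0)).
  have := Gamma_mul (Gamma_mul (@Gamma_B R) Gamma_invA) Gamma_invB.
  by rewrite figB_eis !eis_matM => /Gamma_pole_eis_mat; apply.
have shift z (m n : int) :
    Gamma_pole (eisC z) -> Gamma_pole (eisC (z + (m + 2 * n, 4 * n))).
  have GA := @Gamma_A R; have GL := Gamma_longitude.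
  rewrite /eis_mat eisC0 in GL.
  have mN1 : eisC (-1, 0) * eisC (-1, 0) = 1 by rewrite -eisCM eisC1.
  move=> /(Gamma_pole_shift m (mulr1 1) GA)/(Gamma_pole_shift n mN1 GL).
  congr Gamma_pole; rewrite -eisCM eisCD /eisC /=.
  by rewrite !(rmorphD, rmorphM, rmorphN) /=; ring.
(* Two points whose second coordinates agree mod [4] differ by a vector of the
   cusp lattice. *)
have e4 := divz_eq q.2 4; have r0 := modz_ge0 q.2 (isT : 4 != 0 :> int).
have r4 := ltz_pmod q.2 (isT : 0 < 4 :> int).
have reduce z : Gamma_pole (eisC z) -> (q.2 - z.2 = 4 * ((q.2 - z.2) %/ 4)%Z) ->
    Gamma_pole (eisC q).
  move=> Gz h; pose k := ((q.2 - z.2) %/ 4)%Z.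
  have := shift z (q.1 - z.1 - 2 * k) k Gz; congr (Gamma_pole (eisC _)).
  by rewrite -h; case: (q) (z) => [? ?] [? ?]; congr pair => /=; ring.
case E : (q.2 %% 4)%Z r0 r4 => [[|[|[|[|//]]]]|] // _ _.
- by apply: (reduce _ poleBab) => /=; lia.
- by apply: (reduce _ poleb) => /=; lia.
- by apply: (reduce _ poleBAb) => /=; lia.
by apply: (reduce _ poleB) => /=; lia.
Qed.

(** [Gamma] has a single cusp: it moves every [z / w] to infinity. This is
    Euclid's algorithm run inside [Gamma]. With [q] the rounded quotient of [z]
    by [w], an element with pole [q] turns the denominator [w] into a unit times
    [z - q * w], which has smaller norm. *)
Lemma Gamma_cusp_transitive z w :
  exists2 g : 'M[R[i]]_2, Gamma g & g 1 0 * eisC z + g 1 1 * eisC w = 0.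
Proof.
have [n] := ubnP `|eis_norm w|%N; elim: n z w => // n IH z w wn.
have [w0|w0] := eqVneq (eis_norm w) 0.
  exists 1%:M; first exact: Gamma_1.
  by rewrite !mxE /= (eis_norm_eq0 w0) eisC0 mul0r mulr0 addr0.
have {w0} : 0 < eis_norm w by rewrite lt_neqAle eq_sym w0 eis_norm_ge0.
move=> /(eis_euclid z) [q hq].
have [g Gg [g11 g10]] := Gamma_pole_eis q.
have [_ [a [b [c [d gE]]]]] := Gamma_SL2_eis Gg.
have rE : eisC (eis_mul c z + eis_mul d w) = g 1 0 * eisC (z - eis_mul q w).
  rewrite !eisCD eisCN !eisCM.
  have -> : eisC c = g 1 0 by rewrite gE mxE.
  have -> : eisC d = g 1 1 by rewrite gE mxE.
  by rewrite g11; ring.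
have : eis_norm (eis_mul c z + eis_mul d w) < eis_norm w.
  have := congr1 (@abs2 R) rE; rewrite abs2M g10 mul1r !abs2_eisC.
  by move/eqP; rewrite eqr_int => /eqP ->.
move=> lt; have := eis_norm_ge0 (eis_mul c z + eis_mul d w) => ge.
have [|h Gh hE] := IH (eis_mul a z + eis_mul b w) (eis_mul c z + eis_mul d w).
  by lia.
exists (h *m g); first exact: Gamma_mul.
rewrite [h]mat2E gE mat2M !mxE /= -hE !eisCD !eisCM; ring.
Qed.

(** Take [g] in [Gamma] sending the cusp [1 / z] to infinity. Its lower left
    entry is [- d * z] with [d] its lower right entry, and [d] divides
    [det g = 1]. *)
Lemma Gamma_lower_left z :
  exists2 g : 'M[R[i]]_2, Gamma g & abs2 (g 1 0) = (eis_norm z)%:~R.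
Proof.
have [g Gg cE] := Gamma_cusp_transitive (1, 0) z; exists g => //.
have [dg [a [b [c [d gE]]]]] := Gamma_SL2_eis Gg.
move: dg cE; rewrite gE det_mat2 !mxE /= eisC1 mulr1 => dg /eqP.
rewrite addr_eq0 => /eqP cE.
have d1 : eis_norm d = 1.
  apply: (@eisC_unit_norm _ (a + eis_mul b z)).
  by rewrite eisCD eisCM -dg cE; ring.
by rewrite cE abs2N abs2M !abs2_eisC d1 mul1r.
Qed.

End EisensteinMatrices.

Section UpperHalfSpace.
Variable R : realType.
Local Open Scope complex_scope.
Implicit Types (g h : 'M[R[i]]_2) (p q : R[i] * R) (S T : set (R[i] * R)).

(** * Hyperbolic space as Hermitian matrices *)

Lemma abs2C (z : R[i]) : (abs2 z)%:C = z * conjc z.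
Proof.
by case: z => a b; apply/eqP; rewrite /abs2 eq_complex /=; apply/andP; split;
  apply/eqP; ring.
Qed.

Lemma abs2DC (z : R[i]) (t : R) :
  (abs2 z + t ^+ 2)%:C = z * conjc z + t%:C ^+ 2.
Proof. by rewrite -abs2C -rmorphXn -rmorphD. Qed.

(** The point [(z, t)] as the positive definite Hermitian matrix
    [(|z|^2 + t^2, z; conj z, 1) / t] of determinant one. In this model of
    hyperbolic space [SL2] acts by [g P g^*], so that the action law and the
    invariance of distance become matrix identities. *)
Definition herm p : 'M[R[i]]_2 :=
  mat2 ((abs2 p.1 + p.2 ^+ 2)%:C / p.2%:C) (p.1 / p.2%:C)
       (conjc p.1 / p.2%:C) (p.2%:C)^-1.

Definition star g : 'M[R[i]]_2 :=
  mat2 (conjc (g 0 0)) (conjc (g 1 0)) (conjc (g 0 1)) (conjc (g 1 1)).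

Lemma starM g h : star (g *m h) = star h *m star g.
Proof.
rewrite [g]mat2E [h]mat2E mat2M /star !mxE /= mat2M.
by congr mat2; rewrite rmorphD !rmorphM /=; ring.
Qed.

Lemma star1 : star 1%:M = 1%:M.
Proof. by rewrite /star !mxE !conjc_nat /= -mat2_1. Qed.

Lemma H3_neq0 p : H3 p -> p.2%:C != 0.
Proof. by move=> hp; rewrite eq_complex /= eqxx andbT gt_eqF. Qed.

Lemma det_herm p : H3 p -> \det (herm p) = 1.
Proof.
move=> /H3_neq0 t0; rewrite det_mat2 abs2DC.
by field.
Qed.

Lemma herm_inj p q : H3 p -> H3 q -> herm p = herm q -> p = q.
Proof.
case: p q => [z t] [w s] /H3_neq0 /= t0 /H3_neq0 /= s0 E.
have := congr1 (fun M : 'M[R[i]]_2 => M 1 1) E; rewrite !mxE /= => /invr_inj ts.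
have := congr1 (fun M : 'M[R[i]]_2 => M 0 1) E; rewrite !mxE /= ts => zw.
congr pair; last by case: ts.
by apply: mulIf zw; rewrite invr_eq0.
Qed.

(** In [herm_act] this replaces the computation of the upper left entry: both
    sides have determinant one. *)
Lemma mat2_det_inj (a b c d a' : R[i]) : d != 0 ->
  \det (mat2 a b c d) = \det (mat2 a' b c d) -> mat2 a b c d = mat2 a' b c d.
Proof. by move=> d0; rewrite !det_mat2 => /addIr /(mulIf d0) ->. Qed.

Definition SL2_den g p : R :=
  abs2 (g 1 0 * p.1 + g 1 1) + abs2 (g 1 0) * p.2 ^+ 2.

Lemma SL2_den_gt0 g p : \det g = 1 -> H3 p -> 0 < SL2_den g p.
Proof.
move=> dg hp; have t0 : 0 < p.2 ^+ 2 by rewrite exprn_gt0.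
have A0 := abs2_ge0 (g 1 0 * p.1 + g 1 1).
have B0 := mulr_ge0 (abs2_ge0 (g 1 0)) (ltW t0).
rewrite lt_neqAle eq_sym addr_ge0 // andbT paddr_eq0 //.
rewrite mulf_eq0 (gt_eqF t0) orbF !abs2_eq0.
apply/negP => /andP[/eqP cd /eqP c]; move/eqP: dg; rewrite [g]mat2E det_mat2.
move: cd; rewrite c mul0r add0r => ->; rewrite !mulr0 subr0.
by rewrite eq_sym oner_eq0.
Qed.

Lemma SL2_act2 g p : (SL2_act g p).2 = p.2 / SL2_den g p.
Proof. by []. Qed.

Lemma H3_act g p : \det g = 1 -> H3 p -> H3 (SL2_act g p).
Proof. by move=> dg hp; apply: divr_gt0 => //; apply: SL2_den_gt0. Qed.

Lemma det_star g : \det (star g) = conjc (\det g).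
Proof.
by rewrite [g]mat2E /star !mxE /= !det_mat2 rmorphB !rmorphM /=; ring.
Qed.

Lemma herm_act g p : \det g = 1 -> H3 p ->
  herm (SL2_act g p) = g *m herm p *m star g.
Proof.
move=> dg hp; have hgp := H3_act dg hp.
have t0 := H3_neq0 hp; have D0 := SL2_den_gt0 dg hp.
have DC0 : (SL2_den g p)%:C != 0 by rewrite eq_complex /= eqxx andbT gt_eqF.
have DE : (SL2_den g p)%:C = (g 1 0 * p.1 + g 1 1) * conjc (g 1 0 * p.1 + g 1 1)
   + g 1 0 * conjc (g 1 0) * p.2%:C ^+ 2.
  by rewrite /SL2_den rmorphD rmorphM rmorphXn /= !abs2C.
have gt : (SL2_act g p).2%:C = p.2%:C / (SL2_den g p)%:C.
  by rewrite SL2_act2 rmorphM fmorphV.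
have gz : (SL2_act g p).1 = ((g 0 0 * p.1 + g 0 1) * conjc (g 1 0 * p.1 + g 1 1)
   + g 0 0 * conjc (g 1 0) * p.2%:C ^+ 2) / (SL2_den g p)%:C.
  by rewrite /SL2_act /= rmorphXn.
move: (SL2_act g p) hgp gt gz => P hP gt gz.
have e11 : herm P 1 1 = (g *m herm p *m star g) 1 1.
  rewrite [g in RHS]mat2E /herm /star !mat2M !mxE /= gt invf_div DE.
  rewrite abs2DC rmorphD rmorphM /=.
  by field.
have e01 : herm P 0 1 = (g *m herm p *m star g) 0 1.
  rewrite [g in RHS]mat2E /herm /star !mat2M !mxE /= gz gt.
  rewrite invf_div [LHS]mulrA (divfK DC0) abs2DC rmorphD rmorphM.
  by field.
have e10 : herm P 1 0 = (g *m herm p *m star g) 1 0.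
  transitivity (conjc (herm P 0 1)).
    by rewrite !mxE /= rmorphM fmorphV /= oppr0.
  rewrite e01 [g]mat2E /herm /star !mat2M !mxE /=.
  rewrite abs2DC.
  (* The height is real, so conjugation fixes it. *)
  move: t0 (conjc_real p.2); move: p.2%:C => t t0 tc.
  rewrite !(rmorphD, rmorphM, fmorphV, rmorphXn) /= !conjcK tc.
  by field.
rewrite [LHS]mat2E [RHS]mat2E -e11 -e01 -e10.
apply: mat2_det_inj; first by rewrite mxE /= invr_eq0 H3_neq0.
rewrite -mat2E e11 e01 e10 -mat2E.
by rewrite !det_mulmx det_star dg !det_herm // conjc1 !mul1r.
Qed.

(** Immediate for [P |-> g P g^*], hence true on points because [herm] is
    injective. *)
Lemma SL2_actM g h p : \det g = 1 -> \det h = 1 -> H3 p ->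
  SL2_act (g *m h) p = SL2_act g (SL2_act h p).
Proof.
move=> dg dh hp; have dgh : \det (g *m h) = 1 by rewrite det_mulmx dg dh mulr1.
apply: herm_inj; try by do ?apply: H3_act.
by rewrite !herm_act ?starM ?mulmxA //; apply: H3_act.
Qed.

Lemma SL2_act1 p : H3 p -> SL2_act 1%:M p = p.
Proof.
move=> hp; apply: herm_inj => //; first by apply: H3_act => //; rewrite det1.
by rewrite herm_act ?det1 // mul1mx star1 mulmx1.
Qed.

Definition cosh_hdist p q : R :=
  1 + (abs2 (p.1 - q.1) + (p.2 - q.2) ^+ 2) / (2 * p.2 * q.2).

(** The invariant form of the distance: [2 cosh d(p, q) = tr (P Q^-1)]. *)
Lemma cosh_hdist_trace p q : H3 p -> H3 q ->
  (2 * cosh_hdist p q)%:C = \tr (herm p *m invmx (herm q)).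
Proof.
move=> hp hq; have t0 := H3_neq0 hp; have s0 := H3_neq0 hq.
rewrite invmx_mat2 -?det_mat2 ?det_herm // mat2M /mxtrace !big_ord_recl big_ord0 !mxE /=.
rewrite /cosh_hdist !abs2DC rmorphM rmorph_nat rmorphD fmorph_div /= abs2DC.
rewrite 2!rmorphM rmorph_nat !rmorphB rmorph1 /=.
by field; rewrite t0 s0.
Qed.

Lemma invmxM n (A B : 'M[R[i]]_n) : A \in unitmx -> B \in unitmx ->
  invmx (A *m B) = invmx B *m invmx A.
Proof.
move=> UA UB; have UAB : A *m B \in unitmx by rewrite unitmx_mul UA.
apply: (can_inj (mulKmx UAB)).
by rewrite mulmxV // mulmxA -(mulmxA A) mulmxV // mulmx1 mulmxV.
Qed.

(** The action conjugates [P Q^-1] by [g], which does not change the trace. *)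
Lemma hdist_act g p q : \det g = 1 -> H3 p -> H3 q ->
  hdist (SL2_act g p) (SL2_act g q) = hdist p q.
Proof.
move=> dg hp hq.
suff e : cosh_hdist (SL2_act g p) (SL2_act g q) = cosh_hdist p q.
  by rewrite /hdist -/(cosh_hdist p q) -e.
have n2 : (2 : R) != 0 by rewrite pnatr_eq0.
apply: (mulfI n2); apply: (@complexI R).
have U M : \det M = 1 -> M \in unitmx by rewrite unitmxE => ->; apply: unitr1.
have Ug : g \in unitmx by apply: U.
have Us : star g \in unitmx by apply: U; rewrite det_star dg conjc1.
have Uq : herm q \in unitmx by apply: U; apply: det_herm.
rewrite !cosh_hdist_trace //; try exact: H3_act.
rewrite !herm_act // !invmxM ?unitmx_mul ?Ug ?Uq // !mulmxA mulmxK //.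
by rewrite mxtrace_mulC !mulmxA mulVmx // mul1mx.
Qed.

(** * Distances between horospheres *)

Lemma arcosh_le (x y : R) : 1 <= x -> x <= y -> arcosh x <= arcosh y.
Proof.
move=> x1 xy; have s z := sqrtr_ge0 (z ^+ 2 - 1 : R).
rewrite /arcosh ler_ln ?posrE ?ltr_wpDr ?(lt_le_trans ltr01) ?(le_trans x1) //.
by apply: lerD => //; apply: ler_wsqrtr; nra.
Qed.

(** [cosh (ln n) = (n + 1 / n) / 2]. *)
Lemma arcosh_mean_inv (n : R) : 1 <= n -> arcosh ((n + n^-1) / 2) = ln n.
Proof.
move=> n1; have n0 : n != 0 by rewrite gt_eqF // (lt_le_trans ltr01).
have i1 : n^-1 <= 1 by rewrite invf_le1 // (lt_le_trans ltr01).
rewrite /arcosh.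
have -> : ((n + n^-1) / 2) ^+ 2 - 1 = ((n - n^-1) / 2) ^+ 2 by field.
rewrite sqrtr_sqr ger0_norm; last by rewrite divr_ge0 // subr_ge0 (le_trans i1).
by congr ln; field.
Qed.

Lemma inf_attained (E : set R) m : E m -> lbound E m -> inf E = m.
Proof.
move=> Em lb; apply/le_anti/andP; split; first by apply: ge_inf => //; exists m.
by apply: lb_le_inf => //; exists m.
Qed.

Lemma set_hdist_act g S T : \det g = 1 -> S `<=` @H3 R -> T `<=` @H3 R ->
  set_hdist (SL2_act g @` S) (SL2_act g @` T) = set_hdist S T.
Proof.
move=> dg hS hT; congr inf; apply/seteqP; split=> [d|d].
  move=> [_ [p Sp <-] [_ [q Tq <-] <-]]; exists p => //; exists q => //.
  by rewrite hdist_act //; [apply: hS | apply: hT].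
move=> [p Sp [q Tq <-]]; exists (SL2_act g p); first by exists p.
exists (SL2_act g q); first by exists q.
by rewrite hdist_act //; [apply: hS | apply: hT].
Qed.

Lemma horosphere_H3 : @horosphere_infty R `<=` @H3 R.
Proof. by move=> p []. Qed.

Lemma SL2_act_imageM g h : \det g = 1 -> \det h = 1 ->
  SL2_act (g *m h) @` @horosphere_infty R =
  SL2_act g @` (SL2_act h @` @horosphere_infty R).
Proof.
move=> dg dh; rewrite image_comp; apply: eq_imagel => p [hp _].
exact: SL2_actM.
Qed.

(** With [N = |c|^2], the points of the image horosphere have height
    [1 / (|c * w + d|^2 + N) <= 1 / N], so it is the sphere of diameter [1 / N]
    based at [g oo]. The distance from height one down to height [1 / N] along a
    vertical geodesic is [ln N], attained over [w = - d / c]. *)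
Lemma set_hdist_horosphere g : \det g = 1 -> 1 <= abs2 (g 1 0) ->
  set_hdist (@horosphere_infty R) (SL2_act g @` @horosphere_infty R) =
  ln (abs2 (g 1 0)).
Proof.
move=> dg c1; have c0 : g 1 0 != 0.
  by rewrite -abs2_eq0 gt_eqF // (lt_le_trans ltr01).
rewrite -arcosh_mean_inv //; set N := abs2 _ in c1 *.
have N0 : 0 < N by apply: lt_le_trans c1.
have height q : @horosphere_infty R q ->
    (SL2_act g q).2 = (abs2 (g 1 0 * q.1 + g 1 1) + N)^-1.
  by case=> _ q1; rewrite SL2_act2 /SL2_den q1 expr1n mulr1 mul1r.
apply: inf_attained.
  pose q : R[i] * R := (- g 1 1 / g 1 0, 1).
  have Hq : @horosphere_infty R q by split; rewrite /H3 //=.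
  exists ((SL2_act g q).1, 1); first by split; rewrite /H3 //=.
  exists (SL2_act g q); first by exists q.
  rewrite /hdist (height q Hq).
  have -> : g 1 0 * q.1 + g 1 1 = 0 by rewrite /= mulrC divfK // addNr.
  rewrite /= subrr /abs2 /= expr0n /= !add0r; congr arcosh; field.
  by rewrite gt_eqF.
move=> _ [p [_ p1] [_ [q Hq <-] <-]]; apply: arcosh_le.
  rewrite ler_pdivlMr // mul1r.
  have : 0 <= (N - 1) ^+ 2 / N by rewrite divr_ge0 ?sqr_ge0 // ltW.
  have -> : (N - 1) ^+ 2 / N = N + N^-1 - 2 by field; rewrite gt_eqF.
  by rewrite subr_ge0.
rewrite p1 height //; set a := abs2 (p.1 - _); set b := abs2 (_ + _).
have a0 : 0 <= a by apply: abs2_ge0.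
have b0 : 0 <= b by apply: abs2_ge0.
have D0 : 0 < b + N by apply: ltr_wpDl.
(* [cosh d] for heights [1] and [1 / D], with [D = b + N], splits into a
   horizontal term and [cosh (ln D)]. *)
have -> : 1 + (a + (1 - (b + N)^-1) ^+ 2) / (2 * 1 * (b + N)^-1) =
    a * (b + N) / 2 + (b + N + (b + N)^-1) / 2 by field; rewrite gt_eqF.
apply: (@le_trans _ _ ((b + N + (b + N)^-1) / 2)); last first.
  by rewrite lerDr divr_ge0 ?mulr_ge0 ?(ltW D0).
rewrite ler_pM2r ?invr_gt0 // -subr_ge0.
have -> : b + N + (b + N)^-1 - (N + N^-1) = b * ((b + N) * N - 1) / ((b + N) * N).
  by field; rewrite !gt_eqF.
apply: divr_ge0; apply: mulr_ge0 => //; try exact: ltW.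
by rewrite subr_ge0; nra.
Qed.

Lemma SL2_eis_unit_lower_right g : SL2_eis g -> g 1 0 = 0 -> abs2 (g 1 1) = 1.
Proof.
move=> [dg [a [b [c [d gE]]]]] g10; rewrite gE mxE /= abs2_eisC.
rewrite (@eisC_unit_norm R d a) // -dg [g]mat2E det_mat2 g10 gE !mxE /=.
by rewrite mulr0 subr0 mulrC.
Qed.

(** An upper triangular element has unit diagonal entries, hence preserves
    heights. *)
Lemma SL2_act_horosphere_sub g : SL2_eis g -> g 1 0 = 0 ->
  SL2_act g @` @horosphere_infty R `<=` @horosphere_infty R.
Proof.
move=> eg g10 _ [p [hp p1] <-]; split; first by apply: H3_act => //; case: eg.
rewrite SL2_act2 /SL2_den g10 mul0r add0r (SL2_eis_unit_lower_right eg g10) p1.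
by rewrite /abs2 /= expr0n /= addr0 mul0r addr0 divr1.
Qed.

Lemma SL2_act_horosphere_stab g : SL2_eis g -> g 1 0 = 0 ->
  SL2_act g @` @horosphere_infty R = @horosphere_infty R.
Proof.
move=> eg g10; apply/seteqP; split; first exact: SL2_act_horosphere_sub.
have [dg _] := eg; have [dV _] := SL2_eis_inv eg.
move=> p Hp; exists (SL2_act (invmx g) p).
  apply: (SL2_act_horosphere_sub (SL2_eis_inv eg)); last by exists p.
  rewrite [g]mat2E invmx_mat2 -?det_mat2 -?mat2E // mxE /=.
  by rewrite g10 oppr0.
have [hp _] := Hp; rewrite -SL2_actM // mulmxV ?SL2_act1 //.
by rewrite unitmxE dg unitr1.
Qed.

(** Any [w] with [|c * w + d| = 1] is sent to height [1 / (1 + |c|^2) < 1]. *)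
Lemma SL2_act_horosphere_neq g : \det g = 1 -> g 1 0 != 0 ->
  SL2_act g @` @horosphere_infty R <> @horosphere_infty R.
Proof.
move=> dg c0 E; pose q : R[i] * R := ((1 - g 1 1) / g 1 0, 1).
have [_] : @horosphere_infty R (SL2_act g q).
  by rewrite -E; exists q => //; split; rewrite /H3 //=.
have qE : g 1 0 * q.1 + g 1 1 = 1 by rewrite /= mulrC divfK // subrK.
have -> : (SL2_act g q).2 = (1 + abs2 (g 1 0))^-1.
  by rewrite SL2_act2 /SL2_den qE {1}/abs2 /= expr1n expr0n /= addr0 mulr1 mul1r.
move/eqP; rewrite invr_eq1 -subr_eq0 addrAC subrr add0r abs2_eq0.
by rewrite (negPf c0).
Qed.

End UpperHalfSpace.

Theorem corollary1p4 (R : realType) :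
  canonical_distances R = [set ln (n%:R : R) | n in admissible].
Proof.
apply/seteqP; split=> [_ [_ [_ [[g Gg ->] [h Gh ->] neq ->]]]|_ [n An <-]].
  have [dg _] := Gamma_SL2_eis Gg; have [dh _] := Gamma_SL2_eis Gh.
  have Ug : g \in unitmx by rewrite unitmxE dg unitr1.
  have /Gamma_SL2_eis Ek := Gamma_mul (Gamma_inv Gg) Gh.
  have [dk [a [b [c [d kE]]]]] := Ek.
  have hE : SL2_act h @` @horosphere_infty R =
      SL2_act g @` (SL2_act (invmx g *m h) @` @horosphere_infty R).
    by rewrite -SL2_act_imageM // mulKVmx.
  rewrite hE in neq *; set k := invmx g *m h in Ek dk kE neq *.
  have cE : k 1 0 = eisC R c by rewrite kE mxE.
  have c0 : eisC R c != 0.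
    apply/eqP => c0; apply: neq.
    by rewrite (SL2_act_horosphere_stab (g := k)) ?cE.
  have [n nE] : exists n : nat, eis_norm c = n.
    by move: (eis_norm_ge0 c); case: (eis_norm c) => // n _; exists n.
  have n0 : (0 < n)%N.
    rewrite lt0n -eqz_nat -nE; apply: contraNneq c0 => /eis_norm_eq0 ->.
    by rewrite eisC0.
  have cn : abs2 (k 1 0) = n%:R by rewrite cE abs2_eisC nE -pmulrn.
  exists n; first by apply/admissible_eis_represented; split=> //; exists c.
  rewrite set_hdist_act //; first last.
  - by move=> _ [p [hp _] <-]; apply: H3_act.
  - exact: horosphere_H3.
  by rewrite set_hdist_horosphere // cn // ler1n.
have /admissible_eis_represented[n0 [z zn]] := An.
have [g Gg gz] := Gamma_lower_left R z.
have [dg _] := Gamma_SL2_eis Gg.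
have gn : abs2 (g 1 0) = n%:R by rewrite gz zn -pmulrn.
have HE : SL2_act 1%:M @` @horosphere_infty R = @horosphere_infty R.
  apply: SL2_act_horosphere_stab; last by rewrite mxE.
  exact/Gamma_SL2_eis/Gamma_1.
exists (@horosphere_infty R), (SL2_act g @` @horosphere_infty R); split.
- by exists 1%:M => //; exact: Gamma_1.
- by exists g.
- move/esym; apply: SL2_act_horosphere_neq => //.
  by rewrite -abs2_eq0 gn pnatr_eq0 -lt0n.
by rewrite set_hdist_horosphere // gn // ler1n.
Qed.
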